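(* Let $p>3$ be a prime. The coefficients of the polynomial $f_{3p}$ all lie in the set $\{-2,-1,0,1,2\}$.
   Context: For an integer $n>1$, $F_n(x)=\sum_{0\le a\le n-1,\ \gcd(a,n)=1}x^a\in\mathbb{Z}[x]$. For $n=pq$ with odd primes $p>q$, let $$S_n=\{d>1 : d\neq q,\ d\mid p-1\}\cup\{d>1 : d\mid q-1\}\cup\{d>1 : d\mid\gcd(pq+1,p+q)\}.$$ The polynomial $f_n\in\mathbb{Z}[x]$ is defined by $F_n(x)=f_n(x)\cdot x\cdot\prod_{d\in S_n}\Phi_d(x)$, where $\Phi_d$ is the $d$-th cyclotomic polynomial (each $\Phi_d$ with $d\in S_n$ divides $F_n$, so $f_n$ is well defined). Here $q=3$ and $n=3p$. *)

(* Defs.v *)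
From mathcomp Require Import all_boot all_order all_algebra all_field.
From mathcomp Require Import ring.

Set Implicit Arguments.
Unset Strict Implicit.
Unset Printing Implicit Defensive.

Import GRing.Theory Num.Theory.
Local Open Scope ring_scope.

Definition F_poly (n : nat) : {poly int} :=
  \sum_(0 <= a < n | coprime a n) 'X^a.

(* [undup]: the three divisor sets may overlap, and the product of the
   cyclotomic factors runs over their union. *)
Definition S_set (p q : nat) : seq nat :=
  undup ([seq d <- divisors p.-1 | (1 < d)%N & d != q]
      ++ [seq d <- divisors q.-1 | (1 < d)%N]
      ++ [seq d <- divisors (gcdn (p * q + 1) (p + q)) | (1 < d)%N]).

Definition f_den (p q : nat) : {poly int} :=
  'X * \prod_(d <- S_set p q) 'Phi_d.

(* f_n for n = p * q.  The divisor is monic, so this is Euclidean division in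
   Z[x]; [f_polyP] and [f_poly_uniq] show that, for primes p > q, it is the unique
   polynomial f_n with F_n = f_n * x * \prod_(d in S_n) Phi_d. *)
Definition f_poly (p q : nat) : {poly int} := F_poly (p * q) %/ f_den p q.

Section WellDefined.

Local Notation ZtoC := (intr : int -> algC).
Local Notation pZtoC := (map_poly ZtoC).

Variables p q : nat.
Hypotheses (p_pr : prime p) (q_pr : prime q) (ltqp : (q < p)%N).

Let sum_dvd (z : algC) (k m : nat) : (0 < k)%N ->
  \sum_(0 <= a < k * m | (k %| a)%N) z ^+ a = \sum_(0 <= i < m) (z ^+ k) ^+ i.
Proof.
move=> k_gt0; elim: m => [|m IHm]; first by rewrite muln0 !big_geq.
rewrite big_nat_recr //= -IHm mulnS addnC.
rewrite (@big_cat_nat _ _ _ (k * m)) ?leq_addr //=; congr (_ + _).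
rewrite big_mkcond big_ltn_cond /=; last by rewrite -[ltnLHS]addn0 ltn_add2l.
rewrite dvdn_mulr // exprM big_nat_cond big1 ?addr0 // => a /andP[/andP[lo hi] _].
case: ifP => // /dvdnP[j Dj]; move: lo hi; rewrite Dj (mulnC j) -mulnSr.
by rewrite !ltn_pmul2l // ltnS ltnNge => /negPf->.
Qed.

Let F_eval (z : algC) : (pZtoC (F_poly (p * q))).[z] =
  \sum_(0 <= a < p * q) z ^+ a - \sum_(0 <= i < q) (z ^+ p) ^+ i
  - \sum_(0 <= i < p) (z ^+ q) ^+ i + 1.
Proof.
have p0 := prime_gt0 p_pr; have q0 := prime_gt0 q_pr.
have co_pq: coprime p q.
  by rewrite prime_coprime // dvdn_prime2 // neq_ltn ltqp orbT.
rewrite -!sum_dvd // [(q * p)%N]mulnC.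
have E1: 1 = \sum_(0 <= a < p * q | (p * q %| a)%N) z ^+ a.
  by have := @sum_dvd z (p * q) 1; rewrite muln_gt0 p0 muln1 big_nat1 => ->.
rewrite [X in _ = _ + X]E1 /F_poly rmorph_sum /= horner_sum.
rewrite big_mkcond [in X in _ - X]big_mkcond [in X in _ - X - _]big_mkcond.
rewrite [in X in _ + X]big_mkcond -!sumrB -big_split /=.
apply: eq_bigr => a _; rewrite map_polyXn hornerXn coprime_sym coprimeMl.
rewrite !prime_coprime // Gauss_dvd //.
by do 2![case: (_ %| a)%N] => /=; ring.
Qed.

Let geom (y : algC) n : y != 1 -> \sum_(0 <= i < n) y ^+ i = (y ^+ n - 1) / (y - 1).
Proof.
move=> y1; rewrite big_mkord subrX1 mulrC mulKf // subr_eq0 //.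
Qed.

Let field_id1 (F : fieldType) (y z : F) : z - 1 != 0 -> y - 1 != 0 ->
  (y - 1) / (z - 1) - (y - 1) / (z - 1) - (y - 1) / (y - 1) + 1 = 0.
Proof. by move=> z1 y1; field; rewrite z1 y1. Qed.

Let field_id2 (F : fieldType) (z w : F) :
    z != 0 -> w != 0 -> z - 1 != 0 -> w - 1 != 0 ->
  (z^-1 - 1) / (z - 1) - (z^-1 - 1) / (w - 1) - (z^-1 - 1) / (w^-1 - 1) + 1 = 0.
Proof.
move=> z0 w0 z1 w1; field; rewrite z0 w0 z1 w1 /=.
by rewrite andbT mulN1r subr_eq0 eq_sym -subr_eq0.
Qed.

Let F_root d (z : algC) :
  d \in S_set p q -> d.-primitive_root z -> (pZtoC (F_poly (p * q))).[z] = 0.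
Proof.
have p1 := prime_gt1 p_pr; have q1 := prime_gt1 q_pr.
move=> dS zd.
have d1: (1 < d)%N.
  by move: dS; rewrite mem_undup !mem_cat !mem_filter => /or3P[] /andP[] // /andP[].
have nz1: z - 1 != 0.
  rewrite subr_eq0 -[z]expr1 -(prim_order_dvd zd) gtnNdvd //.
have nzn (n : nat) : ~~ (d %| n)%N -> z ^+ n - 1 != 0.
  by rewrite subr_eq0 -(prim_order_dvd zd).
have z1: z != 1 by rewrite -subr_eq0.
have z0: z != 0 by rewrite (prim_root_eq0 zd) -lt0n ltnW.
have pred1 n : (0 < n)%N -> (d %| n.-1)%N -> z ^+ n = z.
  by move=> n0; rewrite (prim_order_dvd zd) -{2}(prednK n0) exprS => /eqP->; rewrite mulr1.
rewrite F_eval.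
have pp: (0 < p.-1)%N by rewrite -subn1 subn_gt0.
have qq: (0 < q.-1)%N by rewrite -subn1 subn_gt0.
have gg: (0 < gcdn (p * q + 1) (p + q))%N by rewrite gcdn_gt0 addn1.
move: dS; rewrite mem_undup !mem_cat !mem_filter -!dvdn_divisors //.
case/or3P=> /andP[].
- case/andP=> _ dq dp; have zp := pred1 _ (ltnW p1) dp.
  have zq: z ^+ q - 1 != 0.
    by apply: nzn; apply/prime_nt_dvdP; rewrite ?neq_ltn ?d1 ?orbT //; apply/eqP.
  have yq: z ^+ q != 1 by rewrite -subr_eq0.
  rewrite zp (geom _ z1) (geom _ z1) (geom _ yq) exprM [(z ^+ q) ^+ p]exprAC zp.
  exact: field_id1.
- move=> _ dq; have zq := pred1 _ (ltnW q1) dq.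
  have zp: z ^+ p - 1 != 0.
    apply: nzn; apply/prime_nt_dvdP; rewrite ?neq_ltn ?d1 ?orbT // => dp.
    move: dq; rewrite dp gtnNdvd //.
    by rewrite prednK ?(ltnW q1) // ltnW.
  have yp: z ^+ p != 1 by rewrite -subr_eq0.
  rewrite zq (geom _ z1) (geom _ yp) (geom _ z1) mulnC exprM.
  rewrite [(z ^+ p) ^+ q]exprAC zq.
  by rewrite [X in X + 1]addrAC; exact: field_id1.
- move=> _; rewrite dvdn_gcd => /andP[dn ds].
  have zn: z * (z ^+ p) ^+ q = 1.
    by apply/eqP; rewrite -exprM -exprS -addn1 -(prim_order_dvd zd).
  have zs: z ^+ p * z ^+ q = 1.
    by apply/eqP; rewrite -exprD -(prim_order_dvd zd).
  have co r m : (d %| r * m + 1)%N -> ~~ (d %| r)%N.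
    apply: contraL => dr; apply/negP; rewrite dvdn_addr ?dvdn_mulr // dvdn1 => /eqP D.
    by rewrite D in d1.
  have zp := nzn _ (co _ _ dn).
  have zq: z ^+ q - 1 != 0 by apply: nzn; rewrite (co _ p) // mulnC.
  have wE: z ^+ q = (z ^+ p)^-1.
    by rewrite -[RHS]mulr1 -zs mulKf // expf_neq0.
  have vE: (z ^+ p) ^+ q = z^-1 by rewrite -[RHS]mulr1 -zn mulKf.
  have yp: z ^+ p != 1 by rewrite -subr_eq0.
  have yq: z ^+ q != 1 by rewrite -subr_eq0.
  rewrite (geom _ z1) (geom _ yp) (geom _ yq) exprM [(z ^+ q) ^+ p]exprAC vE wE.
  apply: (field_id2 z0 _ nz1 zp); exact: expf_neq0.
Qed.

Lemma f_den_monic : f_den p q \is monic.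
Proof.
by rewrite monicMl ?monicX // monic_prod // => d _; apply: Cyclotomic_monic.
Qed.

Let cyclotomic_root d (z : algC) : (0 < d)%N ->
  root (pZtoC 'Phi_d) z = d.-primitive_root z.
Proof.
move=> d_gt0; have [y yd] := C_prim_root_exists d_gt0.
by rewrite (Cintr_Cyclotomic yd) root_cyclotomic.
Qed.

Let cyclotomic_dvd d :
  d \in S_set p q -> (0 < d)%N -> pZtoC 'Phi_d %| pZtoC (F_poly (p * q)).
Proof.
move=> dS d_gt0; have [z zd] := C_prim_root_exists d_gt0.
have [m [Dm _ dv_m]] := minCpolyP z.
rewrite (Cintr_Cyclotomic zd) -(minCpoly_cyclotomic zd) Dm.
have E: pZtoC (F_poly (p * q)) = map_poly ratr (map_poly intr (F_poly (p * q)) : {poly rat}).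
  by rewrite -map_poly_comp; apply: eq_map_poly => a /=; rewrite ratr_int.
by rewrite E dvdp_map -dv_m -E rootE (F_root dS zd).
Qed.

Let S_gt0 d : d \in S_set p q -> (0 < d)%N.
Proof.
rewrite mem_undup !mem_cat !mem_filter.
by case/or3P=> /andP[] => [/andP[]||] /ltnW.
Qed.

Let cyclotomic_prod_dvd (s : seq nat) : uniq s -> {subset s <= S_set p q} ->
  \prod_(d <- s) pZtoC 'Phi_d %| pZtoC (F_poly (p * q)).
Proof.
elim: s => [|d s IHs] /=; first by rewrite big_nil dvd1p.
case/andP=> ds us sS; have dS: d \in S_set p q by rewrite sS ?mem_head.
have sS' e : e \in s -> e \in S_set p q by move=> es; rewrite sS // inE es orbT.
rewrite big_cons Gauss_dvdp; first by rewrite cyclotomic_dvd ?S_gt0 ?IHs.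
apply: Pdiv.ClosedField.root_coprimep => x; rewrite cyclotomic_root ?S_gt0 // => xd.
rewrite horner_prod prodf_seq_neq0; apply/allP => e es /=.
change (~~ root (pZtoC 'Phi_e) x); rewrite cyclotomic_root ?S_gt0 ?sS' //.
apply/negP=> xe; suff de : d = e by rewrite de es in ds.
apply/eqP; rewrite eqn_dvd (prim_order_dvd xd) (prim_order_dvd xe).
by rewrite (prim_expr_order xd) (prim_expr_order xe) eqxx.
Qed.

Let f_den_dvd : f_den p q %| F_poly (p * q).
Proof.
have [u [r [Dr lt_r]]] : exists u r : {poly int},
    F_poly (p * q) = u * f_den p q + r /\ (size r < size (f_den p q))%N.
  exists (F_poly (p * q) %/ f_den p q), (F_poly (p * q) %% f_den p q).
  split; first exact: (Pdiv.IdomainMonic.divp_eq f_den_monic).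
  by rewrite ltn_modp monic_neq0 ?f_den_monic.
suff r0: r = 0 by rewrite Dr r0 addr0 dvdp_mull // dvdpp.
have size_C (g : {poly int}) : size (pZtoC g) = size g.
  by rewrite size_map_inj_poly ?rmorph0 //; apply: intr_inj.
have dvC: pZtoC (f_den p q) %| pZtoC (F_poly (p * q)).
  rewrite rmorphM /= map_polyX rmorph_prod /= Gauss_dvdp.
    rewrite cyclotomic_prod_dvd ?undup_uniq // andbT.
    rewrite -['X]subr0 dvdp_XsubCl rootE -(rmorph0 ZtoC) horner_map /=.
    rewrite /F_poly horner_sum big_mkcond big_nat_cond big1 ?rmorph0 // => i _.
    case: ifP => // co; rewrite hornerXn expr0n; case: i co => // /eqP.
    rewrite gcd0n => /eqP; rewrite muln_eq1 => /andP[/eqP p1].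
    by have:= prime_gt1 p_pr; rewrite p1.
  rewrite coprimep_sym coprimepX rootE horner_prod prodf_seq_neq0.
  apply/allP => e es /=; change (~~ root (pZtoC 'Phi_e) 0).
  rewrite cyclotomic_root ?S_gt0 //; apply/negP => e0.
  by have:= prim_root_eq0 e0; rewrite eqxx eqn0Ngt S_gt0.
move: dvC; rewrite Dr rmorphD (rmorphM _ u) /= dvdp_addr ?dvdp_mull ?dvdpp // => dvr.
apply/eqP; rewrite -size_poly_eq0 -size_C size_poly_eq0; apply: contraTT lt_r => r0.
by rewrite -leqNgt -!size_C dvdp_leq.
Qed.

Lemma f_polyP : F_poly (p * q) = f_poly p q * f_den p q.
Proof.
by apply/eqP; rewrite -(Pdiv.IdomainMonic.dvdp_eq f_den_monic) f_den_dvd.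
Qed.

Lemma f_poly_uniq (g : {poly int}) :
  F_poly (p * q) = g * f_den p q -> g = f_poly p q.
Proof. by rewrite /f_poly => ->; rewrite Pdiv.IdomainMonic.mulpK ?f_den_monic. Qed.

End WellDefined.

(* Main.v *)
Require Import Defs.
From mathcomp Require Import all_boot all_order all_algebra all_field.
From mathcomp Require Import ring zify.

Import GRing.Theory Num.Theory.
Local Open Scope ring_scope.

(** Put [m = p - 1] and [y = X^m].  The terms of [F_3p] form two geometric
progressions of ratio [X^3] with the exponents [p] and [2p] removed, whence
[(X^3 - 1) F_3p = X (y - 1) G] with
[G = (1 + X) + (X + X^3) y + (X^3 + X^4) y^2] ([F_poly_closed]).

As [gcd (3p + 1, p + 3) = gcd (8, p + 3)], the set [S_3p] consists of the divisors
of [m] other than [1] and [3], together with [8] when [p = 5] modulo [8].  So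
the denominator [f_den p 3] satisfies [(X^3 - 1) f_den = X (y - 1) D]
([f_den_closed]), where [D] is the product of [1 + X + X^2], present when [3] does
not divide [m], and of [1 + X^4], present when [p = 5] modulo [8].  Thus
[f_3p] is the quotient [G / D].

If [D = 1], the coefficients of [G] are [0] and [1].  Otherwise [D] divides
[X^N - 1] for [N = 3], [8] or [24], the exponent [m] is [m0 + N t] for a fixed
[m0], and the power series [1 / D] is periodic of period [N].  The coefficients
of [G / D] are therefore [t] copies of a block of length [N], [t] copies of a
second block, and a tail independent of [t], with a fixed short correction added
where the second run begins.  [periodic_quotient] makes this precise, and it remains to
exhibit the blocks and to read that their entries are at most [2] in absolute
value. *)

(** * Polynomials with small coefficients *)

(** All coefficients lie in the interval from [-2] to [2]. *)
Definition small_poly (P : {poly int}) := forall i, `|P`_i| <= 2.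

Lemma small_Poly (s : seq int) : all (fun c => `|c| <= 2) s -> small_poly (Poly s).
Proof.
move=> /(all_nthP 0) ss i; rewrite coef_Poly.
by have [/ss|/(nth_default 0)->] := ltnP i (size s); rewrite ?normr0.
Qed.

Lemma small_cat n (A B : {poly int}) : (size A <= n)%N ->
  small_poly A -> small_poly B -> small_poly (A + 'X^n * B).
Proof.
move=> sA hA hB i; rewrite coefD coefXnM; case: ltnP => hi; first by rewrite addr0.
by rewrite (nth_default 0 (leq_trans sA hi)) add0r.
Qed.

Lemma small_geom_cat n t (A B : {poly int}) : (size A <= n)%N ->
    small_poly A -> small_poly B ->
  small_poly ((\sum_(s < t) 'X^n ^+ s) * A + 'X^n ^+ t * B).
Proof.
move=> sA hA hB; elim: t => [|t IHt].
  by rewrite big_ord0 mul0r add0r expr0 mul1r.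
rewrite big_ord_recl expr0.
under eq_bigr => s _ do rewrite exprS.
rewrite -mulr_sumr exprS mulrDl mul1r -addrA -!mulrA -mulrDr.
exact: small_cat.
Qed.

(** The quotient by [D] of [P0 + P1 X^(N t) + P2 X^(2 N t)], for [D] dividing
[X^N - 1].  Its coefficients are [t] copies of the block [R1], then [t] copies
of the block [R2], then [T], with [C] added from position [N t] on, that is to
the first copy of [R2], or to [T] when [t = 0].  The hypotheses on
[R1], [R2], [T] say that [R1 / (1 - X^N)] is the periodic series [P0 / D] and
that [P2 / D = T + R2 / (X^N - 1)]; the last identity is the case [t = 0]. *)
Lemma periodic_quotient N t (D P0 P1 P2 R1 R2 C T : {poly int}) :
    (size R1 <= N)%N -> (size R2 <= N)%N -> (size (C + R2)%R <= N)%N ->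
    small_poly R1 -> small_poly R2 -> small_poly T ->
    small_poly (C + R2) -> small_poly (C + T) ->
    D * R1 = (1 - 'X^N) * P0 ->
    D * R2 = ('X^N - 1) * (P2 - D * T) ->
    D * (C + T) = P0 + P1 + P2 ->
  exists2 f, small_poly f &
    P0 + P1 * 'X^N ^+ t + P2 * ('X^N ^+ t) ^+ 2 = f * D.
Proof.
move=> sR1 sR2 sCR hR1 hR2 hT hCR hCT E1 E2 E3.
pose U k : {poly int} := \sum_(s < k) 'X^N ^+ s.
exists (U t * R1 + 'X^N ^+ t * (C + (U t * R2 + 'X^N ^+ t * T))).
  apply: small_geom_cat => //; case: t => [|t].
    by rewrite /U big_ord0 mul0r add0r expr0 mul1r.
  rewrite /U big_ord_recl expr0.
  under eq_bigr => s _ do rewrite exprS.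
  rewrite -mulr_sumr exprS mulrDl mul1r !addrA -addrA -!mulrA -mulrDr.
  by apply: small_cat => //; apply: small_geom_cat.
have EU : ('X^N - 1) * U t = 'X^N ^+ t - 1 by rewrite -subrX1.
have F1 : U t * (D * R1) = (1 - 'X^N ^+ t) * P0.
  by rewrite E1 -[1 - 'X^N ^+ t]opprB -EU; ring.
have F2 : U t * (D * R2) = ('X^N ^+ t - 1) * (P2 - D * T) by rewrite E2 -EU; ring.
set w := 'X^N ^+ t in F1 F2 *.
transitivity (U t * (D * R1) + w * (D * (C + T) - D * T + U t * (D * R2) + w * (D * T))).
  by rewrite F1 F2 E3; ring.
ring.
Qed.

(** * Closed forms of the numerator and of the denominator *)

(** The numerator [G] of [f_3p] before simplification, as a function of
[y = X^(p-1)]. *)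
Definition numer (y : {poly int}) : {poly int} :=
  1 + 'X + ('X + 'X^3) * y + ('X^3 + 'X^4) * y ^+ 2.

(** The divisor [D] such that [f_3p = G / D]: the factor [1 + X + X^2 = Phi_3] is
part of [(X^(p-1) - 1) / (X - 1)] exactly when [3] divides [p - 1], and
[1 + X^4 = Phi_8] comes from the common divisors of [3p + 1] and [p + 3]. *)
Definition denom (p : nat) : {poly int} :=
  (if (3 %| p.-1)%N then 1 else 1 + 'X + 'X^2)
  * (if (p %% 8 == 5)%N then 1 + 'X^4 else 1).

Lemma sum_not_dvd3 n :
  ('X^3 - 1) * (\sum_(0 <= a < n * 3 | ~~ (3 %| a)%N) 'X^a)
    = ('X + 'X^2) * ('X^(n * 3) - 1) :> {poly int}.
Proof.
elim: n => [|n IHn]; first by rewrite big_geq // mulr0 expr0 subrr mulr0.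
rewrite mulSn addnC addn3 [in LHS]big_mkcond !big_nat_recr //= -big_mkcond /=.
have -> : (3 %| n * 3)%N by lia.
have -> : (3 %| (n * 3).+1)%N = false by lia.
have -> : (3 %| (n * 3).+2)%N = false by lia.
rewrite /= addr0 2!mulrDr IHn !exprS; ring.
Qed.

Lemma sum_mult_not_dvd3 p : (0 < p)%N -> coprime p 3 ->
  \sum_(0 <= a < p * 3 | ~~ (3 %| a)%N && (p %| a)%N) 'X^a
    = 'X^p + 'X^p ^+ 2 :> {poly int}.
Proof.
move=> p0 cp3; rewrite -big_filter (perm_big [:: p; p * 2]%N) /=.
  by rewrite !big_cons big_nil addr0 -exprM.
have n3 : ~~ (3 %| p)%N by rewrite -prime_coprime // coprime_sym.
apply: uniq_perm => [||a]; first by rewrite filter_uniq ?iota_uniq.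
  by rewrite /= inE; lia.
rewrite mem_filter mem_index_iota !inE.
apply/idP/idP => [/andP[/andP[na /dvdnP[k Dk]] ha]|].
  have : (k < 3)%N by rewrite -(ltn_pmul2l p0) mulnC -Dk; case/andP: ha.
  by case: k Dk => [|[|[|]]] // Dk _; move: na; rewrite Dk; lia.
case/orP=> /eqP->; first by rewrite n3 dvdnn /=; lia.
by rewrite (dvdn_mulr (d := p)) //; lia.
Qed.

Lemma F_poly_closed p : prime p -> (3 < p)%N ->
  ('X^3 - 1) * F_poly (p * 3) = 'X * ('X^(p.-1) - 1) * numer 'X^(p.-1).
Proof.
move=> pp p3; have p0 := prime_gt0 pp.
have cp3 : coprime p 3 by rewrite prime_coprime // gtnNdvd.
have -> : F_poly (p * 3) = (\sum_(0 <= a < p * 3 | ~~ (3 %| a)%N) 'X^a)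
    - (\sum_(0 <= a < p * 3 | ~~ (3 %| a)%N && (p %| a)%N) 'X^a).
  rewrite (bigID (fun a => p %| a)%N) /= addrC addrK /F_poly.
  apply: eq_bigl => a; rewrite coprime_sym coprimeMl !prime_coprime //.
  by rewrite andbC.
rewrite mulrBr sum_not_dvd3 sum_mult_not_dvd3 // /numer exprM.
have -> : 'X^p = 'X * 'X^(p.-1) :> {poly int} by rewrite -exprS prednK.
ring.
Qed.

Lemma Cyclotomic1 : 'Phi_1 = 'X - 1 :> {poly int}.
Proof. by rewrite -(prod_Cyclotomic (isT : 0 < 1)%N) /= big_cons big_nil mulr1. Qed.

Lemma Cyclotomic3 : 'Phi_3 = 1 + 'X + 'X^2 :> {poly int}.
Proof.
apply: (mulfI (monic_neq0 (Cyclotomic_monic 1))).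
have := prod_Cyclotomic (isT : 0 < 3)%N.
rewrite (_ : divisors 3 = [:: 1; 3]%N) // !big_cons big_nil mulr1 => ->.
rewrite Cyclotomic1; ring.
Qed.

Lemma Cyclotomic8 : 'Phi_8 = 1 + 'X^4 :> {poly int}.
Proof.
(* Phi_8 is the quotient of X^8 - 1 by X^4 - 1. *)
have n0 : 'X^4 - 1 != 0 :> {poly int} by apply/monic_neq0/monicXnsubC.
apply: (mulfI n0); have := prod_Cyclotomic (isT : 0 < 8)%N.
have := prod_Cyclotomic (isT : 0 < 4)%N.
rewrite (_ : divisors 8 = [:: 1; 2; 4; 8]%N) // (_ : divisors 4 = [:: 1; 2; 4]%N) //.
rewrite !big_cons !big_nil !mulr1 => E4 E8; transitivity ('X^8 - 1 : {poly int}).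
  by rewrite -E4 -!mulrA.
ring.
Qed.

(** The divisors [2] and [4] contributed by [q - 1 = 2] and by
[gcd (3p + 1, p + 3)] already divide [p - 1]; only [8] can be new. *)
Lemma perm_S_set p : prime p -> (3 < p)%N ->
  perm_eq (S_set p 3)
    ([seq d <- divisors p.-1 | (1 < d)%N & d != 3]
       ++ if (p %% 8 == 5)%N then [:: 8] else [::]).
Proof.
move=> pp p3; have odp : odd p by case: (even_prime pp) => // p2; rewrite p2 in p3.
have p2 : (2 %| p.-1)%N by lia.
have p4 : (4 %| p + 3)%N = (4 %| p.-1)%N by lia.
have p8 : (8 %| p + 3)%N = (p %% 8 == 5)%N by lia.
have [p10 g0] : (0 < p.-1)%N /\ (0 < gcdn (p * 3 + 1) (p + 3))%N.
  by split; rewrite ?gcdn_gt0; lia.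
apply: uniq_perm => [||d]; first exact: undup_uniq.
  rewrite cat_uniq filter_uniq ?divisors_uniq //=.
  case: eqP => //= p5; rewrite orbF mem_filter -dvdn_divisors //=.
  by rewrite andbT; lia.
rewrite /S_set mem_undup !mem_cat !mem_filter -!dvdn_divisors //.
have -> : (d \in if (p %% 8 == 5)%N then [:: 8] else [::]) = (p %% 8 == 5)%N && (d == 8).
  by case: ifP; rewrite ?inE.
have gE : (d %| gcdn (p * 3 + 1) (p + 3))%N = (d %| 8)%N && (d %| p + 3)%N.
  (* Modulo p + 3, the number 3p + 1 is -8. *)
  have -> : (p * 3 + 1 = (p + 3) * 3 - 8)%N by lia.
  rewrite dvdn_gcd; case: (boolP (d %| p + 3)%N) => dp; last by rewrite !andbF.
  by rewrite !andbT dvdn_subr ?dvdn_mulr //; lia.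
rewrite gE.
have d8 : (d %| 8)%N = (d \in [:: 1; 2; 4; 8]%N) by rewrite dvdn_divisors.
have d2 : (d %| 2)%N = (d \in [:: 1; 2]%N) by rewrite dvdn_divisors.
rewrite d8 d2 !inE.
have [->|n2] := eqVneq d 2; first by rewrite p2.
have [->|n4] := eqVneq d 4; first by rewrite p4 /= andbF orbF orbb.
have [->|n8] := eqVneq d 8; first by rewrite p8 /= andbT.
by have [->|n1] := eqVneq d 1%N; rewrite ?andbF ?orbF ?andbT.
Qed.

Lemma perm_divisors3 m : (0 < m)%N ->
  perm_eq (divisors m)
    (1%N :: (if (3 %| m)%N then [:: 3] else [::])
       ++ [seq d <- divisors m | (1 < d)%N & d != 3]).
Proof.
move=> m0; apply: uniq_perm => [||d]; first exact: divisors_uniq.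
  by case: ifP; rewrite /= ?inE !mem_filter filter_uniq ?divisors_uniq.
rewrite inE mem_cat mem_filter -!dvdn_divisors //.
have -> : (d \in if (3 %| m)%N then [:: 3] else [::]) = (3 %| m)%N && (d == 3).
  by case: ifP; rewrite ?inE.
have [->|n1] := eqVneq d 1%N; first by rewrite dvd1n.
have [->|n3] := eqVneq d 3; first by rewrite /= andbT orbF.
case: d n1 n3 => [|d] n1 n3; first by rewrite dvd0n eqn0Ngt m0 andbF.
by rewrite andbF /= ltnS lt0n -eqSS n1.
Qed.

Lemma f_den_closed p : prime p -> (3 < p)%N ->
  ('X^3 - 1) * f_den p 3 = 'X * ('X^(p.-1) - 1) * denom p.
Proof.
move=> pp p3; have p10 : (0 < p.-1)%N by lia.
rewrite /f_den /denom (perm_big _ (perm_S_set p pp p3)) big_cat /=.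
rewrite -(prod_Cyclotomic p10) (perm_big _ (perm_divisors3 _ p10)).
rewrite big_cons big_cat /= Cyclotomic1.
do 2![case: ifP => _]; rewrite ?big_cons big_nil ?Cyclotomic3 ?Cyclotomic8; ring.
Qed.

(** * The quotient *)

Lemma f_polyE p f : prime p -> (3 < p)%N ->
  numer 'X^(p.-1) = f * denom p -> f = f_poly p 3.
Proof.
move=> pp p3 E; apply: f_poly_uniq => //.
have n0 : 'X^3 - 1 != 0 :> {poly int} by apply/monic_neq0/monicXnsubC.
apply: (mulfI n0); rewrite F_poly_closed // mulrCA f_den_closed // E; ring.
Qed.

Lemma numer_Xadd m0 N t :
  numer 'X^(m0 + N * t) = (1 + 'X) + ('X + 'X^3) * 'X^m0 * 'X^N ^+ t
    + ('X^3 + 'X^4) * 'X^m0 ^+ 2 * ('X^N ^+ t) ^+ 2.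
Proof. by rewrite /numer exprD exprM; ring. Qed.

Lemma Poly_nil : Poly [::] = 0 :> {poly int}.
Proof. by []. Qed.

Lemma Poly_cons (c : int) (s : seq int) : Poly (c :: s) = c%:P + 'X * Poly s.
Proof. by rewrite /= cons_poly_def addrC mulrC. Qed.

(** Proves an identity between explicit polynomials, some given by their list of
coefficients, by rewriting such lists in Horner form. *)
Ltac horner_ring := rewrite !Poly_cons Poly_nil; ring.

(** The case [D = 1]: the three parts of [G] do not overlap. *)
Lemma quotient_1 m : (4 <= m)%N -> exists2 f, small_poly f & numer 'X^m = f * 1.
Proof.
move=> m4.
pose A : {poly int} := Poly [:: 1; 1].
pose B : {poly int} := Poly [:: 0; 1; 0; 1].
pose C : {poly int} := Poly [:: 0; 0; 0; 1; 1].
exists (A + 'X^m * (B + 'X^m * C)); last by rewrite /numer /A /B /C; horner_ring.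
apply: small_cat; [|exact: small_Poly|apply: small_cat; last exact: small_Poly].
- by apply: leq_trans (size_Poly _) _; apply: leq_trans m4.
- by apply: leq_trans (size_Poly _) _.
- exact: small_Poly.
Qed.

(** In this case and the next two, write [N] for the period and [P2] for the
coefficient of [X^(2 N t)] in [G].  Then [R1] is [(1 - X^N) (1 + X) / D], [T] and
[R2] are the quotient and the remainder of [(X^N - 1) P2 / D] by [X^N - 1], and
[C + T] is the value of [G / D] for [t = 0]. *)
Lemma quotient_3 t :
  exists2 f, small_poly f & numer 'X^(1 + 3 * t) = f * (1 + 'X + 'X^2).
Proof.
pose R1 : {poly int} := Poly [:: 1; 0; -1].
pose R2 : {poly int} := Poly [:: 0; 1; -1].
pose C : {poly int} := Poly [:: 1; -1; 1].
pose T : {poly int} := Poly [:: 0; 1; -1; 0; 1].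
have CR : C + R2 = Poly [:: 1] by rewrite /C /R2; horner_ring.
have CT : C + T = Poly [:: 1; 0; 0; 0; 1] by rewrite /C /T; horner_ring.
rewrite numer_Xadd; apply: (periodic_quotient _ _ _ _ _ _ R1 R2 C T).
- by apply: leq_trans (size_Poly _) _.
- by apply: leq_trans (size_Poly _) _.
- by rewrite CR; apply: leq_trans (size_Poly _) _.
- exact: small_Poly.
- exact: small_Poly.
- exact: small_Poly.
- by rewrite CR; apply: small_Poly.
- by rewrite CT; apply: small_Poly.
- by rewrite /R1; horner_ring.
- by rewrite /R2 /T; horner_ring.
- by rewrite CT; horner_ring.
Qed.

Lemma quotient_8 t :
  exists2 f, small_poly f & numer 'X^(4 + 8 * t) = f * (1 + 'X^4).
Proof.
pose R1 : {poly int} := Poly [:: 1; 1; 0; 0; -1; -1].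
pose R2 : {poly int} := Poly [:: 1; 0; 0; -1; -1; 0; 0; 1].
pose C : {poly int} := Poly [:: 0; 1; 0; 1].
pose T : {poly int} := Poly [:: 1; 0; 0; -1; -1; 0; 0; 1; 1].
have CR : C + R2 = Poly [:: 1; 1; 0; 0; -1; 0; 0; 1] by rewrite /C /R2; horner_ring.
have CT : C + T = Poly [:: 1; 1; 0; 0; -1; 0; 0; 1; 1] by rewrite /C /T; horner_ring.
rewrite numer_Xadd; apply: (periodic_quotient _ _ _ _ _ _ R1 R2 C T).
- by apply: leq_trans (size_Poly _) _.
- by apply: leq_trans (size_Poly _) _.
- by rewrite CR; apply: leq_trans (size_Poly _) _.
- exact: small_Poly.
- exact: small_Poly.
- exact: small_Poly.
- by rewrite CR; apply: small_Poly.
- by rewrite CT; apply: small_Poly.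
- by rewrite /R1; horner_ring.
- by rewrite /R2 /T; horner_ring.
- by rewrite CT; horner_ring.
Qed.

(** The only case in which the coefficients [2] and [-2] occur. *)
Lemma quotient_24 t :
  exists2 f, small_poly f &
    numer 'X^(4 + 24 * t) = f * ((1 + 'X + 'X^2) * (1 + 'X^4)).
Proof.
pose R1 : {poly int} :=
  Poly [:: 1; 0; -1; 1; -1; -1; 2; -1; 0; 2; -2; 0;
           1; -2; 1; 1; -1; 1; 0; -1].
pose R2 : {poly int} :=
  Poly [:: 2; -1; -1; 1; -1; 0; 1; 0; 0; 0; 0; -1;
           0; 1; -1; 1; 1; -2; 1; 0; -2; 2; 0; -1].
pose C : {poly int} := Poly [:: -1; 1].
pose T : {poly int} := Poly [:: 2; -1; -1; 1; -1; 0; 1].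
have CR : C + R2 =
    Poly [:: 1; 0; -1; 1; -1; 0; 1; 0; 0; 0; 0; -1;
             0; 1; -1; 1; 1; -2; 1; 0; -2; 2; 0; -1].
  by rewrite /C /R2; horner_ring.
have CT : C + T = Poly [:: 1; 0; -1; 1; -1; 0; 1] by rewrite /C /T; horner_ring.
rewrite numer_Xadd; apply: (periodic_quotient _ _ _ _ _ _ R1 R2 C T).
- by apply: leq_trans (size_Poly _) _.
- by apply: leq_trans (size_Poly _) _.
- by rewrite CR; apply: leq_trans (size_Poly _) _.
- exact: small_Poly.
- exact: small_Poly.
- exact: small_Poly.
- by rewrite CR; apply: small_Poly.
- by rewrite CT; apply: small_Poly.
- by rewrite /R1; horner_ring.
- by rewrite /R2 /T; horner_ring.
- by rewrite CT; horner_ring.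
Qed.

Theorem theorem4p2 (p : nat) (hp : prime p) (hp3 : (3 < p)%N) :
  forall i : nat, (f_poly p 3)`_i \in [:: -2; -1; 0; 1; 2 : int].
Proof.
suff [f hf Ef] : exists2 f, small_poly f & numer 'X^(p.-1) = f * denom p.
  move=> i; rewrite -(f_polyE p f hp hp3 Ef) !inE; have := hf i; lia.
have n3 : ~~ (3 %| p)%N by rewrite dvdn_prime2 // neq_ltn hp3.
rewrite /denom; case: ifP => p1; case: ifP => p8; rewrite ?mul1r ?mulr1.
- have -> : p.-1 = (4 + 8 * (p %/ 8))%N by lia.
  exact: quotient_8.
- have n4 : p != 4 by apply: contraTneq hp => ->.
  by apply: quotient_1; lia.
- have -> : p.-1 = (4 + 24 * (p %/ 24))%N by lia.
  exact: quotient_24.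
- have -> : p.-1 = (1 + 3 * (p %/ 3))%N by lia.
  exact: quotient_3.
Qed.
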